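(* Let $k\geq 2$ be an integer. Then, as an identity between formal power series, $$\log G_k = G_k^{\min},$$ where $G_k(x)=1+\sum_{n\geq 1}\frac{x^n}{n}\binom{kn}{n-1}$ and $G_k^{\min}(x)=\sum_{n\geq 1}\frac{x^n}{n!}\,|\mathscr P_k^{\min}(n)|$ is the exponential generating function for label-minimal $[n]$-labeled $k$-good paths.
   Context: Here $\mathbb N=\{1,2,3,\dots\}$ and $[n]=\{1,\dots,n\}$. The logarithm of a formal power series with constant term $1$ is the usual formal logarithm. Labeled good paths: let $n\in\mathbb N$, $k\ge 2$, and let $V\subset\mathbb N$ be a finite set with $|V|=n$. A $V$-labeled $k$-good path is a lattice path in $\mathbb Z^2$ from $(0,0)$ to $(n,(k-1)n)$ with steps $(0,1)$ or $(1,0)$ that never rises above the line $y=(k-1)x$, together with a labeling, i.e. a bijection from the set of heights $\{(k-1)j : 0\le j\le n-1\}$ to $V$. The set of these is denoted $\mathscr P_k(V)$. Label-minimal paths: a path $P\in\mathscr P_k(V)$ intersects the diagonal $y=(k-1)x$ at height $(k-1)j$ if it passes through the point $(j,(k-1)j)$. The path $P$ is called label-minimal if the label of height $0$ is minimal among all labels of those heights $(k-1)j$, $0\le j\le n-1$, at which $P$ intersects the diagonal. The set of label-minimal paths in $\mathscr P_k(V)$ is denoted $\mathscr P_k^{\min}(V)$, and $\mathscr P_k^{\min}(n):=\mathscr P_k^{\min}([n])$. *)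

(* Defs.v *)
From mathcomp Require Import all_boot all_order all_algebra.
From mathcomp Require Import finmap.

Set Implicit Arguments.
Unset Strict Implicit.
Unset Printing Implicit Defensive.

Import GRing.Theory Num.Theory.
Local Open Scope ring_scope.

(* A formal power series over the rationals is its sequence of coefficients:
   [f n] is the coefficient of x^n, so equality of series is [=1]. *)
Definition fps := nat -> rat.

Definition fps_one : fps := fun n => (n == 0%N)%:R.

Definition fps_sub (f g : fps) : fps := fun n => f n - g n.

Definition fps_mul (f g : fps) : fps :=
  fun n => \sum_(i < n.+1) f i * g (n - i)%N.

Definition fps_exp (f : fps) (m : nat) : fps := iter m (fps_mul f) fps_one.

(* log F = \sum_(m >= 1) (-1)^(m-1) / m * (F - 1)^m, for F with constant
   term 1.  In the coefficient of x^n, the terms with m > n vanish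
   (fps_exp_low below), so the sum stops at m = n. *)
Definition fps_log (F : fps) : fps := fun n =>
  \sum_(1 <= m < n.+1)
    (-1) ^+ m.-1 / m%:R * fps_exp (fps_sub F fps_one) m n.

Lemma fps_exp_low (f : fps) (m n : nat) :
  f 0%N = 0 -> (n < m)%N -> fps_exp f m n = 0.
Proof.
move=> f0; elim: m n => // m IHm n le_nm /=.
rewrite /fps_mul big1 // => -[[|i] /= lt_in] _; first by rewrite f0 mul0r.
rewrite (IHm (n - i.+1)%N) ?mulr0 //.
rewrite ltnS in le_nm; apply: leq_trans le_nm.
by rewrite ltn_subrL; case: n lt_in.
Qed.

(* A lattice path is its sequence of steps: [true] is the step (0,1) and
   [false] the step (1,0).  [xpos s i] and [ypos s i] are the coordinates of
   the point reached from (0,0) after i steps. *)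
Definition xpos (s : seq bool) (i : nat) : nat := count_mem false (take i s).
Definition ypos (s : seq bool) (i : nat) : nat := count_mem true (take i s).

(* Any path from (0,0) to (n, (k-1)n) has n + (k-1)n = kn steps, whence the
   length.  The region under the line is convex, so staying weakly below it
   need only be tested at lattice points. *)
Definition good_path (k n : nat) (s : (k * n).-tuple bool) : bool :=
  [&& xpos s (k * n) == n,
      ypos s (k * n) == (k.-1 * n)%N
    & [forall i : 'I_(k * n).+1, ypos s i <= k.-1 * xpos s i]%N].

Definition meets_diagonal (k n : nat) (s : (k * n).-tuple bool) (j : nat) :
    bool :=
  [exists i : 'I_(k * n).+1, (xpos s i == j) && (ypos s i == (k.-1 * j)%N)].

(* A labeling attaches labels to the heights (k-1)j, 0 <= j < n, which are
   pairwise distinct for k >= 2; [l j] is the label of height (k-1)j. *)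
Definition is_labeling (n : nat) (V : {fset nat}) (l : {ffun 'I_n -> V}) :
    bool :=
  injectiveb l && [forall v : V, v \in codom l].

Definition labeled_good_paths (k : nat) (V : {fset nat}) :
    {set (k * #|` V|).-tuple bool * {ffun 'I_#|` V| -> V}} :=
  [set P | good_path P.1 && is_labeling P.2].

Definition label_minimal (k n : nat) (V : {fset nat})
    (P : (k * n).-tuple bool * {ffun 'I_n -> V}) : bool :=
  [forall i : 'I_n, forall j : 'I_n,
     (val i == 0%N) && meets_diagonal P.1 j
       ==> (val (P.2 i) <= val (P.2 j))%N].

Definition labeled_min_paths (k : nat) (V : {fset nat}) :
    {set (k * #|` V|).-tuple bool * {ffun 'I_#|` V| -> V}} :=
  [set P in labeled_good_paths k V | label_minimal P].

Definition interval1 (n : nat) : {fset nat} := [fset i in iota 1 n]%fset.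

Definition G (k : nat) : fps := fun n =>
  if n is 0%N then 1 else 'C(k * n, n.-1)%:R / n%:R.

Definition Gmin (k : nat) : fps := fun n =>
  if n is 0%N then 0 else #|labeled_min_paths k (interval1 n)|%:R / n`!%:R.

(* Main.v *)
(* Both sides have [x^n]-coefficient ['C(k n, n) / (k n)].
   For the paths: if [P] meets the diagonal at [r] of the labelled heights,
   then by symmetry a fraction [1 / r] of its labelings is label-minimal, so
   [|P^min(n)| / n! = sum_P 1 / r(P)]; and a word with [n] steps (1,0) and
   [(k-1) n] steps (0,1) has exactly [r] good rotations, namely those starting
   where its height below the diagonal is least, with [r] common to them; so
   counting pairs (word, good rotation) weighted by [1 / r] gives
   [k n * sum_P 1 / r(P) = 'C(k n, n)].
   For the logarithm: [L = log F] is determined by [F * (x L') = x F'], which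
   for these coefficients is an instance of the Rothe-Hagen convolution
   [sum_i 'C(k i, i) * (b / (k (n-i) + b) * 'C(k (n-i) + b, n-i))
    = 'C(k n + b, n)]. *)
Require Import Defs.
From mathcomp Require Import all_boot all_order all_algebra.
From mathcomp Require Import perm finmap zify ring.

Set Implicit Arguments.
Unset Strict Implicit.
Unset Printing Implicit Defensive.

Import Order.TTheory GRing.Theory Num.Theory.
Local Open Scope ring_scope.

(** * The formal logarithm through its differential equation *)

Lemma conv_eq0 (R : nzRingType) (F D : nat -> R) (N : nat) :
  F 0%N = 1 ->
  (forall m, (m < N)%N -> \sum_(i < m.+1) D i * F (m - i)%N = 0) ->
  forall m, (m < N)%N -> D m = 0.
Proof.
move=> F0 conv0; elim/ltn_ind => m IHm lt_mN.
have := conv0 m lt_mN; rewrite big_ord_recr /= subnn F0 mulr1.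
by rewrite big1 ?add0r // => i _; rewrite IHm ?mul0r // (ltn_trans _ lt_mN).
Qed.

(** Truncation makes the product and derivative of [{poly rat}] available for series. *)
Definition fps_poly (n : nat) (f : fps) : {poly rat} := \poly_(i < n.+1) f i.

Lemma coef_fps_poly (n i : nat) (f : fps) :
  (i <= n)%N -> (fps_poly n f)`_i = f i.
Proof. by move=> le_in; rewrite coef_poly ltnS le_in. Qed.

Lemma coef_fps_poly_exp (n m i : nat) (f : fps) :
  (i <= n)%N -> (fps_poly n f ^+ m)`_i = fps_exp f m i.
Proof.
elim: m i => [|m IHm] i le_in; first by rewrite expr0 coef1.
rewrite exprS coefM; apply: eq_bigr => j _.
by rewrite coef_fps_poly ?IHm //; have := ltn_ord j; lia.
Qed.

(* The log equation [F * (x L') = x F'] determines [L]. *)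
Lemma fps_log_unique (F L : fps) :
  F 0%N = 1 -> L 0%N = 0 ->
  (forall n, \sum_(i < n.+1) i%:R * L i * F (n - i)%N = n%:R * F n) ->
  fps_log F =1 L.
Proof.
move=> F0 L0 logF [|n]; first by rewrite /fps_log big_geq ?L0.
set f := fps_sub F fps_one; set p := fps_poly n.+1 f.
(* With [1 + p] standing for [F], [q] is the partial sum of [log (1 + p)]. *)
pose q := \sum_(i < n.+1) ((-1) ^+ i / i.+1%:R) *: p ^+ i.+1.
have fE i : (i <= n.+1)%N -> F i = (1 + p)`_i.
  move=> le_in; rewrite coefD coef1 coef_fps_poly //.
  by rewrite /f /fps_sub /fps_one; case: i le_in => [|i] _ /=; ring.
have logE : fps_log F n.+1 = q`_n.+1.
  rewrite /fps_log big_add1 big_mkord coef_sum; apply: eq_bigr => i _.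
  by rewrite coefZ coef_fps_poly_exp.
have dq : (1 + p) * q^`() = (1 - (- p) ^+ n.+1) * p^`().
  have -> : q^`() = (\sum_(i < n.+1) (- p) ^+ i) * p^`().
    rewrite /q raddf_sum mulr_suml; apply: eq_bigr => i _ /=.
    rewrite derivZ deriv_exp /= -scaler_nat scalerA mulfVK ?pnatr_eq0 //.
    rewrite [(- p) ^+ _]exprNn -mul_polyC polyC_exp polyCN -mulrA.
    by rewrite [_ * p^`()]mulrC.
  rewrite mulrA; congr (_ * _).
  have := subrXX 1 (- p) n.+1; rewrite expr1n opprK => ->.
  by congr (_ * _); apply: eq_bigr => i _; rewrite expr1n mul1r.
have f0 : f 0%N = 0 by rewrite /f /fps_sub /fps_one F0 subrr.
(* As [p] has no constant term, the error term of [dq] starts beyond degree [n]. *)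
have exp_low m : (m <= n)%N -> ((- p) ^+ n.+1)`_m = 0.
  move=> le_mn; rewrite exprNn -signr_odd -[(-1) ^+ _](rmorph_sign polyC).
  by rewrite mul_polyC coefZ coef_fps_poly_exp ?fps_exp_low ?mulr0 //; lia.
have dq_low m : (m <= n)%N -> ((1 + p) * q^`())`_m = m.+1%:R * F m.+1.
  move=> le_mn; rewrite dq mulrBl mul1r coefB [X in _ - X]coefM big1 => [|i _].
    rewrite subr0 coef_deriv fE //.
    by rewrite coefD coef1 add0r mulr_natl.
  by rewrite exp_low ?mul0r //; have := ltn_ord i; lia.
suff conv0 : forall m, (m < n.+1)%N ->
    \sum_(i < m.+1) i.+1%:R * (q`_i.+1 - L i.+1) * F (m - i)%N = 0.
  have /eqP := @conv_eq0 _ F (fun m => m.+1%:R * (q`_m.+1 - L m.+1)) _ F0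
    conv0 n (ltnSn n).
  by rewrite mulf_eq0 pnatr_eq0 /= subr_eq0 logE => /eqP.
move=> m lt_mn; have le_mn : (m <= n)%N by [].
have := dq_low m le_mn; rewrite mulrC coefM -(logF m.+1).
rewrite [X in _ = X -> _]big_ord_recl !mul0r.
rewrite add0r => /eqP; rewrite -subr_eq0 -sumrB => /eqP sum0.
rewrite -[RHS]sum0.
apply: eq_bigr => i _; have le_im := ltn_ord i; rewrite -fE; last by lia.
rewrite coef_deriv /= /bump /= add1n subSS -mulr_natl; ring.
Qed.

(** * Fuss-Catalan powers and the Rothe-Hagen convolution *)

(* [b / (k j + b) * 'C(k j + b, j)], the coefficients of the [b]-th power of
   the Fuss-Catalan series, in a form that avoids [0 / 0] at [b = j = 0]. *)
Definition raney (k b j : nat) : rat :=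
  if j is j'.+1 then b%:R / j%:R * 'C((k * j + b).-1, j')%:R else 1.

(* Coefficientwise, [G^(b+1) = G^b + x G^(b+k)], from [G = 1 + x G^k]. *)
Lemma raneyS (k b j : nat) : (0 < k)%N ->
  raney k b.+1 j.+1 = raney k b j.+1 + raney k (b + k) j.
Proof.
move=> k_gt0; rewrite /raney addnS /=.
case: j => [|j]; first by rewrite !bin0; field.
set M := (k * j.+2 + b).-1.
have -> : (k * j.+2 + b)%N = M.+1 by rewrite /M; lia.
have -> : (k * j.+1 + (b + k)).-1 = M by rewrite /M; lia.
rewrite binS natrD.
(* The ratio of the two neighbouring binomials turns the goal into an identity of rational
   functions. *)
have : (j.+1 * 'C(M, j.+1) = (M - j) * 'C(M, j))%N by rewrite mul_bin_left.
have le_jM : (j <= M)%N by rewrite /M; nia.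
move/(congr1 (fun x => x%:R : rat)); rewrite !natrM natrB //.
have -> : (M%:R : rat) = k%:R * j.+2%:R + b%:R - 1.
  by apply: (canRL (addrK _)); rewrite -natrM -natrD natr1 /M; congr _%:R; lia.
move: ('C(M, j.+1)%:R : rat) ('C(M, j)%:R : rat) => x y.
rewrite !natrD => E.
have j1 : (j.+1%:R : rat) != 0 by rewrite pnatr_eq0.
have j2 : (j.+2%:R : rat) != 0 by rewrite pnatr_eq0.
have -> : x = (k%:R * j.+2%:R + b%:R - 1 - j%:R) * y / j.+1%:R.
  by rewrite -E; field; rewrite nat1r.
rewrite -!natr1; field.
by rewrite !natr1 j1 j2.
Qed.

(** Induction on [n], then on [b]: [raneyS] on the left matches Pascal's rule on the right. At
    [b = 0] only the summand [i = n] survives. *)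
Lemma rothe (k b n : nat) : (0 < k)%N ->
  \sum_(i < n.+1) 'C(k * i, i)%:R * raney k b (n - i) = 'C(k * n + b, n)%:R.
Proof.
move=> k_gt0; elim: n b => [|n IHn] b.
  by rewrite big_ord1 !bin0 mulr1.
elim: b => [|b IHb].
  rewrite big_ord_recr /= subnn big1 => [|i _]; last first.
    by have := ltn_ord i; rewrite ltnS => /subSn -> /=; rewrite !mul0r mulr0.
  by rewrite addn0 add0r mulr1.
(* The summand [i = n.+1], where [raney] is 1 whatever [b] is, goes to the first sum. *)
transitivity (\sum_(i < n.+2) 'C(k * i, i)%:R * raney k b (n.+1 - i)
            + \sum_(i < n.+1) 'C(k * i, i)%:R * raney k (b + k) (n - i)).
  rewrite !(big_ord_recr n.+1) /= !subnn -addrA [X in _ = _ + X]addrC addrA.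
  congr (_ + _); rewrite -big_split; apply: eq_bigr => i _ /=.
  have := ltn_ord i; rewrite ltnS => /subSn ->.
  by rewrite raneyS // mulrDr.
rewrite IHb IHn addnS binS natrD; congr (_ + _%:R).
by congr ('C(_, _)); lia.
Qed.

(** * A weighted cycle lemma *)

Definition good_rots (T : Type) (N : nat) (good : pred (N.-tuple T))
    (w : N.-tuple T) : {set 'I_N} := [set i : 'I_N | good (rot_tuple i w)].

Lemma card_good_rots_rot (T : Type) (N : nat) (good : pred (N.-tuple T))
    (w : N.-tuple T) (j : 'I_N) :
  #|good_rots good (rot_tuple j w)| = #|good_rots good w|.
Proof.
(* Indices of rotations add modulo [N]; a successor makes the index type a group, where translation
   by [j] is a bijection. *)
case: N => [|N] in good w j *; first by case: j.
rewrite -(card_imset _ (@addrI _ j)); apply: eq_card => i.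
rewrite -[i](subrK j) addrC mem_imset ?inE; last exact: addrI.
move: (i - j) => {}i; congr (good _); apply: val_inj => /=.
have := ltn_ord i; have := ltn_ord j.
move: (nat_of_ord i) (nat_of_ord j) => {}i {}j ltj lti.
rewrite rot_add_mod size_tuple ?(ltnW lti) ?(ltnW ltj) // addnC.
case: (ltngtP (j + i) N.+1) => [lt_ij | gt_ij | ->].
- by rewrite modn_small.
- have -> // : ((j + i) %% N.+1 = j + i - N.+1)%N.
  by rewrite -[in LHS](subnK (ltnW gt_ij)) modnDr modn_small //; lia.
- by rewrite modnn rot0 rot_oversize ?size_tuple.
Qed.

(** Double counting of pairs of a word and a good rotation; the weight is constant on rotation
    classes, so each word of [W] receives total weight 1. *)
Lemma cycle_lemma (T : finType) (N : nat) (W : {set N.-tuple T})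
    (good : pred (N.-tuple T)) :
  (forall w, good w -> w \in W) ->
  (forall w i, (rot_tuple i w \in W) = (w \in W)) ->
  {in W, forall w, exists i : 'I_N, good (rot_tuple i w)} ->
  \sum_(w | good w) (#|good_rots good w|%:R)^-1
    = #|W|%:R / N%:R :> rat.
Proof.
move=> sGW rotW ex_good; pose r (w : N.-tuple T) := #|good_rots good w|.
case: (posnP N) => [N0 | N_gt0].
  have W0 : W = set0.
    apply/setP=> w; rewrite inE; apply/negP => /ex_good[[i lt_iN] _].
    by rewrite N0 in lt_iN.
  rewrite W0 cards0 mul0r big_pred0 // => w.
  by apply/negP => /sGW; rewrite W0 inE.
apply: (canRL (mulfK _)); first by rewrite pnatr_eq0 -lt0n.
transitivity (\sum_(i < N) \sum_(w | good (rot_tuple i w)) (r w)%:R^-1 : rat).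
  transitivity (\sum_(i < N) \sum_(w | good w) (r w)%:R^-1 : rat).
    by rewrite sumr_const card_ord mulr_natr.
  apply: eq_bigr => i _.
  rewrite (reindex (fun w : N.-tuple T => rot_tuple i w)) /=.
    by apply: eq_bigr => w _; rewrite /r card_good_rots_rot.
  exists (fun w : N.-tuple T => rotr_tuple i w) => w _; apply: val_inj.
    exact: rotK.
  exact: rotrK.
rewrite (exchange_big_dep (mem W)) /=.
  rewrite -sum1_card natr_sum; apply: eq_bigr => w Ww.
  rewrite sumr_const.
  have -> : #|(fun i : 'I_N => good (rot_tuple i w))| = r w.
    by apply: eq_card => i; rewrite inE.
  rewrite -[LHS]mulr_natr mulVf // pnatr_eq0 -lt0n; apply/card_gt0P.
  by have [i ?] := ex_good w Ww; exists i; rewrite inE.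
by move=> i w _ /sGW; rewrite rotW.
Qed.

(** * Labelings whose minimum on [J] is at a given place *)

(** Each injective labeling attains its minimum on [J] at exactly one index, and transpositions show
    that all indices of [J] occur equally often. *)
Lemma card_min_labelings (n : nat) (V : {fset nat}) (J : {set 'I_n})
    (i0 : 'I_n) :
  #|` V| = n -> i0 \in J ->
  (#|[set l : {ffun 'I_n -> V} | is_labeling l
        & [forall j in J, val (l i0) <= val (l j)]]| * #|J| = n`!)%N.
Proof.
move=> cV Ji0.
have labE (l : {ffun 'I_n -> V}) : is_labeling l = injectiveb l.
  rewrite /is_labeling andb_idr // => /injectiveP inj_l; apply/forallP.
  by apply: inj_card_onto => //; rewrite card_ord -cardfE cV.
pose A j := [set l : {ffun 'I_n -> V} | injectiveb l
        & [forall i in J, val (l j) <= val (l i)]%N].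
have cA j : j \in J -> #|A j| = #|A i0|.
  move=> Jj; have sub a b : a \in J -> b \in J -> (#|A a| <= #|A b|)%N.
    move=> Ja Jb; pose s (l : {ffun 'I_n -> V}) := [ffun i => l (tperm a b i)].
    have s_inj : injective s.
      move=> l l' /ffunP E; apply/ffunP => i.
      by have := E (tperm a b i); rewrite !ffunE tpermK.
    rewrite -(card_imset _ s_inj); apply/subset_leq_card/subsetP.
    move=> _ /imsetP[l Al ->]; move: Al; rewrite !inE.
    case/andP=> /injectiveP inj_l /forall_inP min_l; apply/andP; split.
      by apply/injectiveP => x y; rewrite !ffunE => /inj_l/perm_inj.
    apply/forall_inP => i Ji; rewrite !ffunE tpermR; apply: min_l.
    by case: tpermP.
  by apply/eqP; rewrite eqn_leq !sub.
have -> : [set l : {ffun 'I_n -> V} | is_labeling l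
        & [forall j in J, val (l i0) <= val (l j)]%N] = A i0.
  by apply/setP=> l; rewrite !inE labE.
transitivity (\sum_(j in J) #|A j|)%N.
  by rewrite (eq_bigr _ cA) sum_nat_const mulnC.
transitivity #|[set l : {ffun 'I_n -> V} | injectiveb l]|; last first.
  by rewrite card_inj_ffuns -cardfE card_ord cV ffactnn.
rewrite -[RHS]sum1_card.
under eq_bigr do rewrite -sum1_card.
rewrite (exchange_big_dep
  (mem [set l : {ffun 'I_n -> V} | injectiveb l])) /=; last first.
  by move=> j l _; rewrite !inE => /andP[].
apply: eq_bigr => l; rewrite inE => inj_l.
pose m := [arg min_(i < i0 in J) val (l i)]%N.
rewrite (big_pred1 m) // => j; rewrite inE inj_l /=.
rewrite /m; case: arg_minnP => // i Ji min_i.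
apply/andP/eqP => [[Jj /forall_inP min_j]|->]; last first.
  by split=> //; apply/forall_inP.
apply: (injectiveP _ inj_l); apply: val_inj; apply/eqP.
by rewrite eqn_leq min_i ?min_j.
Qed.

(** * Words, their rotations and the diagonal *)

Lemma card_tuple_count (N m : nat) :
  #|[set w : N.-tuple bool | count_mem false w == m]| = 'C(N, m).
Proof.
pose f (w : N.-tuple bool) := [set i | ~~ tnth w i].
have f_inj : injective f.
  move=> v w /setP E; apply: eq_from_tnth => i.
  by have := E i; rewrite !inE => /negb_inj.
have cf w : #|f w| = count_mem false w.
  rewrite -sum1_card -[in RHS](map_tnth_enum w) count_map -sum1_count.
  rewrite big_enum_cond /=; apply: eq_bigl => i.
  by rewrite inE; case: (tnth w i).
rewrite -[in RHS](card_ord N) -card_draws -(card_imset _ f_inj).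
apply: eq_card => A; rewrite inE; apply/imsetP/eqP => [[w]|cA].
  by rewrite inE => /eqP cw ->; rewrite cf.
have fA : f [tuple i \notin A | i < N] = A.
  by apply/setP => i; rewrite inE tnth_mktuple negbK.
by exists [tuple i \notin A | i < N]; rewrite ?inE -?cf fA ?cA.
Qed.

(** The signed vertical distance from the endpoint up to the diagonal; an integer, since arbitrary
    words may cross the line. *)
Definition excess (k : nat) (s : seq bool) : int :=
  (k.-1 * count_mem false s)%:Z - (count_mem true s)%:Z.

Lemma excess_cat k s t : excess k (s ++ t) = excess k s + excess k t.
Proof. by rewrite /excess !count_cat; lia. Qed.

Lemma count_true_false (s : seq bool) :
  (count_mem true s + count_mem false s)%N = size s.
Proof.
rewrite -(count_predC (pred1 true)); congr (_ + _)%N.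
by apply: eq_count; case.
Qed.

Lemma excess_eq0 k n (w : (k * n).-tuple bool) :
  (0 < k)%N -> count_mem false w = n -> excess k w = 0.
Proof.
move=> k_gt0 cw; have := count_true_false w.
rewrite /excess cw size_tuple; case: k k_gt0 w {cw} => //= k _ w; lia.
Qed.

Lemma good_pathP k n (w : (k * n).-tuple bool) : (0 < k)%N ->
  reflect (count_mem false w = n /\ forall i, 0 <= excess k (take i w))
          (good_path w).
Proof.
move=> k_gt0; rewrite /good_path /xpos /ypos take_oversize ?size_tuple //.
apply: (iffP and3P) => [[/eqP cw _ /forallP good_w] | [cw good_w]].
  split=> // i; case: (leqP i (k * n)) => [le_i | lt_i].
    by have := good_w (Ordinal (n := (k * n).+1) le_i); rewrite /excess /=; lia.
  by rewrite take_oversize ?size_tuple 1?ltnW // excess_eq0.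
split; first by rewrite cw.
  by have := excess_eq0 k_gt0 cw; rewrite /excess cw; lia.
by apply/forallP => i; have := good_w i; rewrite /excess; lia.
Qed.

Lemma count_rot (T : Type) (a : pred T) i (s : seq T) :
  count a (rot i s) = count a s.
Proof. by rewrite /rot count_cat addnC -count_cat cat_take_drop. Qed.

(** The total excess is 0, so moving the starting point shifts all prefix excesses by one constant,
    even past the wrap-around. *)
Lemma excess_rot k n (w : (k * n).-tuple bool) (i j : nat) :
  (0 < k)%N -> count_mem false w = n ->
  exists j', excess k (take j (rot i w))
    = excess k (take j' w) - excess k (take i w).
Proof.
move=> k_gt0 cw.
have eD : excess k (drop i w) = - excess k (take i w).
  have := excess_eq0 k_gt0 cw.
  by rewrite -[X in excess k X](cat_take_drop i) excess_cat; lia.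
rewrite /rot take_cat; case: ltnP => _.
  exists (i + j)%N; rewrite takeD excess_cat; lia.
rewrite excess_cat eD; have [le_i | lt_i] := leqP (j - size (drop i w)) i.
  by exists (j - size (drop i w))%N; rewrite take_takel //; lia.
exists i; rewrite [take (j - _) _]take_oversize; first by lia.
by rewrite size_take_min geq_min ltnW.
Qed.

Lemma good_rot_min k n (w : (k * n).-tuple bool) i :
  (0 < k)%N -> count_mem false w = n ->
  (forall j, excess k (take i w) <= excess k (take j w)) ->
  good_path (rot_tuple i w).
Proof.
move=> k_gt0 cw min_i; apply/good_pathP => //=; rewrite count_rot; split=> // j.
by have [j' ->] := excess_rot i j k_gt0 cw; rewrite subr_ge0.
Qed.

Lemma exists_good_rot k n (w : (k * n).-tuple bool) :
  (0 < k)%N -> (0 < n)%N -> count_mem false w = n ->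
  exists i : 'I_(k * n), good_path (rot_tuple i w).
Proof.
move=> k_gt0 n_gt0 cw.
have kn_gt0 : (0 < k * n)%N by rewrite muln_gt0 k_gt0.
pose i := [arg min_(i < Ordinal kn_gt0) excess k (take i w)]%O.
exists i; apply: good_rot_min => // j.
rewrite /i; case: arg_minP => // {}i _ min_i.
(* Prefixes of length at least [k * n] are the whole word, with the same excess 0 as the empty
   prefix. *)
have [lt_j | le_j] := ltnP j (k * n); first exact: (min_i (Ordinal lt_j)).
rewrite [take j w]take_oversize ?size_tuple // excess_eq0 //.
by have := min_i (Ordinal kn_gt0) isT; rewrite /= take0 /excess /= muln0.
Qed.

(** Back at the old origin, the rotated path has excess opposite to that of [take i w]; both being
    nonnegative, they vanish. *)
Lemma good_rot_good k n (w : (k * n).-tuple bool) i :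
  (0 < k)%N -> good_path w ->
  good_path (rot_tuple i w) = (excess k (take i w) == 0).
Proof.
move=> k_gt0 /good_pathP-/(_ k_gt0)[cw ge0_w].
apply/idP/eqP => [/good_pathP-/(_ k_gt0)[_ /= ge0_r] | e0].
  have := excess_eq0 k_gt0 cw.
  rewrite -[X in excess k X](cat_take_drop i) excess_cat.
  have := ge0_r (size (drop i w)); rewrite /rot take_size_cat //.
  by have := ge0_w i; lia.
by apply: good_rot_min => // j; rewrite e0.
Qed.

(** The diagonal point with abscissa [j] can only be reached after [j + k.-1 * j = k * j] steps. *)
Lemma meets_diagonalE k n (w : (k * n).-tuple bool) j :
  (0 < k)%N -> (j <= n)%N ->
  meets_diagonal w j = (excess k (take (k * j) w) == 0).
Proof.
move=> k_gt0 le_jn.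
have size_w i : (i <= k * n)%N ->
    (count_mem true (take i w) + count_mem false (take i w) = i)%N.
  by move=> le_i; rewrite count_true_false size_takel ?size_tuple.
have le_kj : (k * j <= k * n)%N by rewrite leq_mul2l le_jn orbT.
have kE : k = k.-1.+1 by rewrite prednK.
apply/existsP/eqP => [[i /andP[/eqP xi /eqP yi]] | e0].
  have := size_w i; rewrite -ltnS ltn_ord => /(_ isT).
  rewrite -/(ypos w i) -/(xpos w i) xi yi -[X in (_ + X)%N]mul1n -mulnDl addn1.
  by rewrite -kE => ->; rewrite /excess -/(ypos w i) -/(xpos w i) xi yi subrr.
have lt_kj : (k * j < (k * n).+1)%N by [].
exists (Ordinal lt_kj); rewrite /xpos /ypos /=.
have := size_w _ le_kj; move: e0; rewrite /excess.
move: (count_mem _ _) (count_mem _ _) => y x; rewrite kE /= => e0 e1.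
apply/andP; split; nia.
Qed.

Lemma card_good_rots_good k n (w : (k * n).-tuple bool) :
  (0 < k)%N -> good_path w ->
  #|good_rots (@good_path k n) w| = #|[set j : 'I_n | meets_diagonal w j]|.
Proof.
move=> k_gt0 good_w.
have lt_k (j : 'I_n) : (k * j < k * n)%N by rewrite ltn_pmul2l.
pose f j := Ordinal (lt_k j).
have f_inj : injective f.
  move=> i j /(congr1 val)/eqP /=; rewrite eqn_pmul2l //.
  by move/eqP/val_inj.
rewrite -(card_imset _ f_inj); apply: eq_card => i.
rewrite inE good_rot_good //; apply/eqP/imsetP => [e0 | [j]]; last first.
  by rewrite inE meets_diagonalE ?(ltnW (ltn_ord j)) // => /eqP e0 ->.
have := count_true_false (take i w); rewrite size_takel; last first.
  by rewrite size_tuple ltnW.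
have := e0; rewrite /excess; set x := count_mem false _; set y := count_mem _ _.
move=> xy xyi; have iE : (i = k * x :> nat)%N.
  by rewrite -xyi -(prednK k_gt0) /= mulSn; lia.
have lt_xn : (x < n)%N by rewrite -(ltn_pmul2l k_gt0) -iE.
exists (Ordinal lt_xn); last exact: val_inj.
by rewrite inE meets_diagonalE ?(ltnW lt_xn) // -iE e0.
Qed.

Lemma sum_good_paths (k n : nat) : (0 < k)%N -> (0 < n)%N ->
  \sum_(w | @good_path k n w) (#|[set j : 'I_n | meets_diagonal w j]|%:R)^-1
    = 'C(k * n, n)%:R / (k * n)%:R :> rat.
Proof.
move=> k_gt0 n_gt0; rewrite -card_tuple_count.
rewrite -(@cycle_lemma _ _ _ (@good_path k n)).
- by apply: eq_bigr => w good_w; rewrite card_good_rots_good.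
- by move=> w /good_pathP-/(_ k_gt0)[cw _]; rewrite inE cw.
- by move=> w i; rewrite !inE /= count_rot.
- by move=> w; rewrite inE => /eqP; apply: exists_good_rot.
Qed.

(** * Coefficients of both series and conclusion *)

Lemma card_labeled_min_paths (k : nat) (V : {fset nat}) : (0 < #|` V|)%N ->
  #|labeled_min_paths k V|%:R
    = (#|` V|)`!%:R * \sum_(w | @good_path k #|` V| w)
        (#|[set j : 'I_#|` V| | meets_diagonal w j]|%:R)^-1 :> rat.
Proof.
set n := #|` V| => n_gt0; pose i0 := Ordinal n_gt0.
pose J (w : (k * n).-tuple bool) := [set j : 'I_n | meets_diagonal w j].
pose A w := [set l : {ffun 'I_n -> V} | is_labeling l
  & [forall j in J w, val (l i0) <= val (l j)]%N].
(* Every path starts on the diagonal. *)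
have J0 w : i0 \in J w.
  rewrite inE; apply/existsP; exists ord0.
  by rewrite /xpos /ypos take0 /= muln0.
have -> : #|labeled_min_paths k V| = (\sum_(w | @good_path k n w) #|A w|)%N.
  under eq_bigr do rewrite -sum1_card.
  rewrite pair_big_dep -sum1_card; apply: eq_bigl => -[w l] /=.
  rewrite !inE /= -andbA; congr [&& _, _ & _].
  apply/forallP/forall_inP => [min_l j | min_l i].
    by rewrite inE => Jj; have /forallP/(_ j) := min_l i0; rewrite Jj.
  apply/forallP => j; apply/implyP => /andP[/eqP i_0 Jj].
  by have -> : i = i0; [exact: val_inj | apply: min_l; rewrite inE].
rewrite natr_sum mulr_sumr; apply: eq_bigr => w _.
rewrite -(@card_min_labelings n V (J w) i0) // natrM mulfK // pnatr_eq0 -lt0n.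
by apply/card_gt0P; exists i0.
Qed.

Lemma Gmin_coef (k n : nat) : (0 < k)%N ->
  Gmin k n.+1 = 'C(k * n.+1, n.+1)%:R / (k * n.+1)%:R.
Proof.
move=> k_gt0; have cV : #|` interval1 n.+1| = n.+1.
  by rewrite /interval1 card_fseq undup_id ?iota_uniq ?size_iota.
rewrite /Gmin card_labeled_min_paths ?cV // sum_good_paths //.
by rewrite mulrC mulKf // pnatr_eq0 -lt0n fact_gt0.
Qed.

Lemma G_raney (k n : nat) : (0 < k)%N -> G k n = raney k 1 n.
Proof.
by move=> k_gt0; case: n => //= n; rewrite addn1 /= mul1r mulrC.
Qed.

Theorem theorem5 (k : nat) (hk : (2 <= k)%N) : fps_log (G k) =1 Gmin k.
Proof.
have k_gt0 : (0 < k)%N by apply: leq_trans hk.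
have k_neq0 : k%:R != 0 :> rat by rewrite pnatr_eq0 -lt0n.
apply: fps_log_unique => // -[|n]; first by rewrite big_ord1 !mul0r.
have n1_neq0 : n.+1%:R != 0 :> rat by rewrite pnatr_eq0.
(* Rothe-Hagen at [b = 1], with its summand [i = 0] moved to the right. *)
have rothe1 : \sum_(i < n.+1) 'C(k * i.+1, i.+1)%:R * G k (n - i)%N
    = 'C(k * n.+1 + 1, n.+1)%:R - G k n.+1.
  rewrite -rothe // [X in _ = X - _]big_ord_recl bin0 mul1r subn0.
  rewrite G_raney // addrC addKr.
  by apply: eq_bigr => i _; rewrite lift0 subSS G_raney.
rewrite big_ord_recl !mul0r add0r.
(* The factor [i.+1] from [x L'] cancels against the denominator [k * i.+1] of [Gmin], leaving
   [1 / k]. *)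
transitivity (\sum_(i < n.+1) 'C(k * i.+1, i.+1)%:R * G k (n - i)%N / k%:R).
  apply: eq_bigr => i _; rewrite lift0 subSS Gmin_coef // natrM invfM.
  by rewrite mulrCA [i.+1%:R * _]mulrC mulfVK ?pnatr_eq0 // mulrAC.
rewrite -mulr_suml rothe1 /G addn1.
(* Absorption expresses the remaining binomial through the one in [G k n.+1]. *)
have : (n.+1 * 'C((k * n.+1).+1, n.+1) = (k * n.+1).+1 * 'C(k * n.+1, n))%N.
  by rewrite mul_bin_diag.
move/(congr1 (fun x => x%:R : rat)); rewrite !natrM -[in RHS]natr1.
rewrite natrM => binE.
apply: (canLR (mulfK _)) => //; apply: (mulfI n1_neq0).
rewrite mulrBr binE /=; move: n.+1%:R n1_neq0 => d d_neq0.
by field.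
Qed.
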